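(* Let $\nu$ be the infinite discrete probability measure on $\mathbb{R}$ with $\nu(\{a_j\})=\frac1{2^j}$ for $j\in\mathbb{N}=\{1,2,\dots\}$, where $a_j=\frac25+\frac15\cdot\frac{2^{j-1}-1}{2^{j-1}}$. Then the quantization dimension $D(\nu)$ (of order $2$) of $\nu$ exists and equals zero, but the quantization coefficient of $\nu$, i.e. the $D(\nu)$-dimensional quantization coefficient, does not exist.
   Context: For $n\in\mathbb{N}$, $V_n(\nu)=\inf\{\int\min_{a\in A}(x-a)^2\,d\nu(x):A\subset\mathbb{R},\ 1\le\mathrm{card}(A)\le n\}$ is the $n$th quantization error of order $2$ with respect to the Euclidean distance. The quantization dimension of order $2$ is $D(\nu)=\lim_{n\to\infty}\frac{2\log n}{-\log V_n(\nu)}$, if this limit exists. For $\kappa>0$ only, the $\kappa$-dimensional lower and upper quantization coefficients (of order $2$) are $\liminf_{n\to\infty}n^{2/\kappa}V_n(\nu)$ and $\limsup_{n\to\infty}n^{2/\kappa}V_n(\nu)$; they are not defined for $\kappa=0$. The quantization coefficient of $\nu$ is understood in dimension $\kappa=D(\nu)$, and ''does not exist'' means that it is not defined because $D(\nu)=0$. *)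

(* Defs.v *)
From HB Require Import structures.
From mathcomp Require Import all_boot all_order all_algebra.
From mathcomp Require Import all_classical all_reals all_analysis.
Set Implicit Arguments.
Unset Strict Implicit.
Unset Printing Implicit Defensive.
Import Order.TTheory GRing.Theory Num.Theory numFieldNormedType.Exports.
Local Open Scope classical_set_scope.
Local Open Scope ring_scope.

(* On the finite nonempty sets A considered below, the infimum is a minimum. *)
Definition min_sqdist (R : realType) (A : set R) (x : R) : R :=
  inf [set (x - a) ^+ 2 | a in A].

Definition distortion (R : realType) (nu : probability (measurableTypeR R) R)
    (A : set R) : \bar R :=
  (\int[nu]_x (min_sqdist A x)%:E)%E.

Definition quantization_error (R : realType)
    (nu : probability (measurableTypeR R) R) (n : nat) : \bar R :=
  ereal_inf [set distortion nu A | A in [set A | A !=set0 /\ (A #<= `I_n)%card]].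

(* Intended for finite quantization errors (nu of finite second moment): the
   library sets (-oo)^-1 = -oo, so an infinite error yields a junk value. A zero
   error yields the ratio 0, since lne 0 = -oo and (+oo)^-1 = 0. *)
Definition quantization_ratio (R : realType)
    (nu : probability (measurableTypeR R) R) (n : nat) : \bar R :=
  (2%:E * lne (n%:R)%:E / - lne (quantization_error nu n))%E.

Definition has_quantization_dimension (R : realType)
    (nu : probability (measurableTypeR R) R) : Prop :=
  cvgn (quantization_ratio nu).

(* Meaningful only under has_quantization_dimension. *)
Definition quantization_dimension (R : realType)
    (nu : probability (measurableTypeR R) R) : \bar R :=
  limn (quantization_ratio nu).

(* The kappa-dimensional lower and upper quantization coefficients, as partial
   functions of kappa: they are undefined (None) unless 0 < kappa < +oo. *)
Definition lower_quantization_coefficient (R : realType)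
    (nu : probability (measurableTypeR R) R) (kappa : \bar R)
    : option (\bar R) :=
  if kappa is k%:E then
    if 0 < k then
      Some (limn_einf
        (fun n => (n%:R `^ (2 / k))%:E * quantization_error nu n)%E)
    else None
  else None.

Definition upper_quantization_coefficient (R : realType)
    (nu : probability (measurableTypeR R) R) (kappa : \bar R)
    : option (\bar R) :=
  if kappa is k%:E then
    if 0 < k then
      Some (limn_esup
        (fun n => (n%:R `^ (2 / k))%:E * quantization_error nu n)%E)
    else None
  else None.

Definition atom (R : realType) (j : nat) : R :=
  2 / 5 + 1 / 5 * ((2 ^+ j.-1 - 1) / 2 ^+ j.-1).

(* Main.v *)
Require Import Defs.
From HB Require Import structures.
From mathcomp Require Import all_boot all_order all_algebra.
From mathcomp Require Import all_classical all_reals all_analysis.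
From mathcomp Require Import measurable_realfun.
From mathcomp Require Import ring lra.
Import Order.TTheory GRing.Theory Num.Theory numFieldNormedType.Exports.
Import HBNNSimple.
Local Open Scope classical_set_scope.
Local Open Scope ring_scope.

(** The quantization errors V_n of nu decay exponentially. The n-th atom lies
    within a multiple of 2^-n of every later one, because the atoms increase
    to 3/5 with geometrically shrinking gaps. Taking the first n atoms as
    centers therefore leaves squared distance 0 to those atoms and at most 2^-n
    to all later ones. The masses of the atoms sum to 1, so nu-almost every
    point is an atom and V_n <= 2^-n ([quantization_error_le]).

    Hence - log V_n >= n log 2 (with the value +oo allowed), whereas log n
    grows more slowly than n; the quotient 2 log n / - log V_n is thus squeezed
    to 0 ([cvg_quantization_ratio]); an upper bound on V_n suffices because a
    smaller V_n only makes the quotient smaller. The dimension being 0, the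
    quantization coefficients are undefined. *)

(** The integral of a nonnegative function is a supremum over the simple
    functions below it, and each of these is measurable and almost everywhere
    at most [c]. Hence the bound holds for every such [f], and it applies to the
    squared distance to a set without studying the measurability of that
    distance. *)
Lemma ae_ge0_integral_le_cst d (T : measurableType d) (R : realType)
    (mu : {measure set T -> \bar R}) (f : T -> \bar R) (c : R) : 0 <= c ->
  (forall x, 0 <= f x)%E -> {ae mu, forall x, (f x <= c%:E)%E} ->
  (\int[mu]_x f x <= c%:E * mu [set: T])%E.
Proof.
move=> c0 f0 fc; rewrite ge0_integralTE//.
apply: ge_ereal_sup => _ [h /= hf <-].
rewrite -integralT_nnsfun -integral_cst//.
apply: ae_ge0_le_integral => //.
- by move=> x _; rewrite lee_fin.
- exact/measurable_EFinP.
- by apply: filterS fc => x fxc _; exact: le_trans (hf x) fxc.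
Qed.

(** For empty [A] this relies on the infimum of the empty set of reals being
    0 by convention. *)
Lemma min_sqdist_ge0 (R : realType) (A : set R) (x : R) : 0 <= min_sqdist A x.
Proof.
rewrite /min_sqdist; have [->|/set0P[a Aa]] := eqVneq A set0.
  by rewrite image_set0 inf0.
by apply: lb_le_inf => [|_ [b _ <-]]; [exists ((x - a) ^+ 2), a|exact: sqr_ge0].
Qed.

Lemma min_sqdist_le (R : realType) (A : set R) (x a : R) :
  A a -> min_sqdist A x <= (x - a) ^+ 2.
Proof.
move=> Aa; apply: ge_inf; last by exists a.
by exists 0 => _ [b _ <-]; exact: sqr_ge0.
Qed.

Lemma quantization_error_ge0 (R : realType)
    (nu : probability (measurableTypeR R) R) (n : nat) :
  (0 <= quantization_error nu n)%E.
Proof.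
apply: le_ereal_inf_tmp => _ [A _ <-]; apply: integral_ge0 => x _.
by rewrite lee_fin min_sqdist_ge0.
Qed.

Lemma atomSE (R : realType) (j : nat) :
  atom R j.+1 = 3 / 5 - 2^-1 ^+ j / 5.
Proof.
rewrite /atom /= exprVn mulrBl divff ?expf_neq0 ?pnatr_eq0//.
by rewrite mul1r; field; rewrite expf_neq0.
Qed.

Lemma atomS_inj (R : realType) : injective (fun j => atom R j.+1).
Proof.
move=> i j; rewrite !atomSE => ij.
have {ij} : (2^-1 : R) ^+ i = 2^-1 ^+ j by lra.
rewrite !exprVn => /invr_inj /eqP; rewrite -!natrX eqr_nat eqn_exp2l//.
by move/eqP.
Qed.

(** The atoms are pairwise distinct, so their masses add up, and the geometric
    series 1/2 + 1/4 + ... is equal to 1. *)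
Lemma ae_atom (R : realType) (nu : probability (measurableTypeR R) R)
    (nu_atom : forall j : nat, (1 <= j)%N ->
       nu [set atom R j] = (1 / 2 ^+ j)%:E) :
  {ae nu, forall x, range (fun j => atom R j.+1) x}.
Proof.
pose F j := [set atom R j.+1].
have mF j : measurable (F j : set (measurableTypeR R)) by exact: measurable_set1.
exists (~` \bigcup_j F j); split.
- by apply: measurableC; exact: bigcup_measurable.
- rewrite probability_setC; last exact: bigcup_measurable.
  rewrite measure_bigcup//; last first.
    apply/trivIsetP => i j _ _ ij; apply/seteqP; split => // x [-> /atomS_inj].
    by apply/eqP.
  suff -> : (\big[+%E/0]_(0 <= i <oo | i \in [set: nat]) nu (F i) = 1)%E.
    by rewrite subee.
  apply/cvg_lim => //.
  rewrite (_ : (fun n => _) = EFin \o series (geometric 2^-1 2^-1)).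
    apply: cvg_EFin; first exact: nearW.
    rewrite [X in _ --> X](_ : 1 = 2^-1 / (1 - 2^-1)); last by field.
    by apply: cvg_geometric_series; rewrite ger0_norm ?invr_ge0// invf_lt1 ?ltr1n.
  apply/funext => n; rewrite /= /series/= -sumEFin.
  apply: eq_big => [i|i _]; first exact: in_setT.
  by rewrite [nu _]nu_atom// div1r -exprVn -exprS.
- by move=> x xF [j _ xj]; apply: xF; exists j.
Qed.

(** The first [n] atoms serve as centers. The estimate is far from sharp (the
    mass 2^-n of the later atoms would give a further factor), but any
    exponential rate makes the dimension vanish. *)
Lemma quantization_error_le (R : realType)
    (nu : probability (measurableTypeR R) R)
    (nu_atom : forall j : nat, (1 <= j)%N ->
       nu [set atom R j] = (1 / 2 ^+ j)%:E) (n : nat) : (0 < n)%N ->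
  (quantization_error nu n <= (2^-1 ^+ n)%:E)%E.
Proof.
case: n => // n _.
pose A := [set atom R i.+1 | i in `I_n.+1].
apply: (@le_trans _ _ (distortion nu A)).
  apply: ereal_inf_lbound; exists A => //; split; last exact: card_image_le.
  by exists (atom R 1); exists 0%N.
rewrite -[leRHS]mule1 -(probability_setT nu).
apply: ae_ge0_integral_le_cst => //.
  by move=> x; rewrite lee_fin min_sqdist_ge0.
have := ae_atom _ _ nu_atom.
apply: filterS; first exact: (ae_filter_ringOfSetsType nu).
move=> _ [k _ <-]; rewrite lee_fin.
(* The center nearest to the atom of index k: that atom itself if it is among
   the first n.+1 ones, and otherwise the last center. *)
have Ai : A (atom R (minn k n).+1).
  by exists (minn k n) => //=; rewrite ltnS geq_minr.
apply: le_trans (min_sqdist_le _ _ _ _ Ai) _.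
case: leqP => kn; first by rewrite subrr expr0n exprn_ge0 ?invr_ge0.
have x1 : (2^-1 : R) ^+ n <= 1 by rewrite exprn_ile1// invf_le1// ler1n.
have yx : (2^-1 : R) ^+ k <= 2^-1 ^+ n.
  by apply: ler_wiXn2l (ltnW kn); rewrite ?invr_ge0// invf_le1// ler1n.
have y0 : (0 : R) <= 2^-1 ^+ k by rewrite exprn_ge0 ?invr_ge0.
rewrite !atomSE [leRHS]exprS.
move: y0 yx x1; set x := _ ^+ n; set y := _ ^+ k => y0 yx x1.
(* As 0 <= x - y <= 1, squaring this difference does not increase it. *)
have dd : (x - y) * (x - y) <= 1 * (x - y).
  by apply: ler_wpM2r; lra.
rewrite (_ : (_ - _) ^+ 2 = (x - y) * (x - y) / 25); last by field.
lra.
Qed.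

(** Apply ln t < t to t = sqrt n; the bound by [n] itself would not suffice to
    make ln n / n vanish in the limit. *)
Lemma ln_nat_le (R : realType) (n : nat) :
  ln (n%:R : R) <= 2 * Num.sqrt n%:R.
Proof.
case: n => [|n]; first by rewrite ln0// mulr_ge0.
have s0 : (0 : R) < Num.sqrt n.+1%:R by rewrite sqrtr_gt0.
rewrite -[X in ln X](@sqr_sqrtr R)//.
by rewrite lnXn// mulr_natl lerMn2r/= ltW// ln_sublinear.
Qed.

(** From - log V_n >= n * (- log q) and log n <= 2 sqrt n, the ratio is at most
    4 / (- log q * sqrt n). An error V_n = 0 is covered: then - log V_n = +oo
    and the ratio is 0. *)
Lemma cvg_quantization_ratio (R : realType)
    (nu : probability (measurableTypeR R) R) (q : R) : 0 < q < 1 ->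
  (\forall n \near \oo, (quantization_error nu n <= (q ^+ n)%:E)%E) ->
  quantization_ratio nu n @[n --> \oo] --> 0%E.
Proof.
move=> /andP[q0 q1] Vq.
have c0 : 0 < - ln q by rewrite oppr_gt0 ln_lt0// q0.
apply: (@squeeze_cvge _ _ _ _ (cst 0%E) _
  (fun n => (4 / - ln q * (Num.sqrt n%:R)^-1)%:E)).
- near=> n.
  have n0 : (0 < n)%N by near: n; exact: nbhs_infty_gt.
  have nR0 : 0 < n%:R :> R by rewrite ltr0n.
  have s0 : (0 : R) < Num.sqrt n%:R by rewrite sqrtr_gt0.
  have V : (quantization_error nu n <= (q ^+ n)%:E)%E by near: n.
  have L : ((n%:R * - ln q)%:E <= - lne (quantization_error nu n))%E.
    rewrite mulrN EFinN leeN2 -[X in (X%:E)]mulrC mulr_natr -lnXn//.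
    rewrite -lne_EFin ?exprn_gt0// lee_lne// in_itv/= leey andbT.
      exact: quantization_error_ge0.
    by rewrite lee_fin exprn_ge0// ltW.
  have L0 : (0 <= (n%:R * - ln q)%:E)%E.
    by rewrite lee_fin mulr_ge0// ltW.
  have N0 : (0 <= 2%:E * lne (n%:R : R)%:E)%E.
    by rewrite mule_ge0// lne_ge0 lee_fin ler1n.
  rewrite /quantization_ratio; apply/andP; split.
    by apply: mule_ge0 => //; rewrite inve_ge0 (le_trans L0).
  apply: (@le_trans _ _ (2%:E * lne (n%:R)%:E / (n%:R * - ln q)%:E)%E).
    by apply: lee_wpmul2l => //; rewrite lee_pV2 ?inE// (le_trans L0 L).
  rewrite lne_EFin// inver gt_eqF ?mulr_gt0// -!EFinM lee_fin.
  apply: (@le_trans _ _ (2 * (2 * Num.sqrt n%:R) / (n%:R * - ln q))).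
    rewrite ler_pM2r ?invr_gt0 ?mulr_gt0// ler_pM2l//; exact: ln_nat_le.
  rewrite le_eqVlt; apply/orP; left; apply/eqP.
  have ns : n%:R = Num.sqrt n%:R ^+ 2 :> R by rewrite sqr_sqrtr.
  move: s0 ns; set s := Num.sqrt _ => s0 ->.
  have lnq0 : ln q != 0 by rewrite -oppr_eq0 gt_eqF.
  by field; rewrite lnq0 gt_eqF.
- exact: cvg_cst.
- rewrite -[X in _ --> X]/((0 : R)%:E).
  apply: cvg_EFin; first exact: nearW.
  rewrite -[X in _ --> X](mulr0 (4 / - ln q)).
  apply: cvgMl_tmp.
  apply/gtr0_cvgV0.
    by near=> n; rewrite sqrtr_gt0 ltr0n; near: n; exact: nbhs_infty_gt.
  apply/cvgryPge => M; near=> n.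
  rewrite (le_trans (ler_norm _))// -sqrtr_sqr ler_wsqrtr//.
  by near: n; exact: nbhs_infty_ger.
Unshelve. all: by end_near.
Qed.

Theorem theorem4p6 (R : realType) (nu : probability (measurableTypeR R) R)
    (nu_atom : forall j : nat, (1 <= j)%N ->
       nu [set atom R j] = (1 / 2 ^+ j)%:E) :
  [/\ has_quantization_dimension nu,
      quantization_dimension nu = 0%E,
      ~ (exists c : \bar R,
          lower_quantization_coefficient nu (quantization_dimension nu)
            = Some c)
    & ~ (exists c : \bar R,
          upper_quantization_coefficient nu (quantization_dimension nu)
            = Some c)].
Proof.
have cvg0 : quantization_ratio nu n @[n --> \oo] --> 0%E.
  apply: (@cvg_quantization_ratio _ _ 2^-1).
    by rewrite invr_gt0 ltr0n/= invf_lt1 ?ltr1n.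
  by exists 1%N => // n /= n0; exact: quantization_error_le nu_atom _ _.
have D0 : quantization_dimension nu = 0%E by exact: cvg_lim.
split => //; first by apply/cvg_ex; exists 0%E.
- by case=> c; rewrite D0 /lower_quantization_coefficient/= ltxx.
- by case=> c; rewrite D0 /upper_quantization_coefficient/= ltxx.
Qed.
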